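(* Let $m<0<M$ be real numbers. For every $f\in\mathcal{F}_{m,M}$ we have $$\exp\left(\int_0^1\log|J(f)(x)|\,dx\right)\leq\frac{1}{e}\cdot\frac{-mM}{M-m}.$$
   Context: For real numbers $m<0<M$, $\mathcal{F}_{m,M}$ denotes the set of functions $f\in L^\infty([0,1])$ (essentially bounded measurable real functions on $[0,1]$) such that $m\leq f\leq M$ and $\int_0^1 f(x)\,dx=0$. For $f\in L^\infty([0,1])$, the continuous function $J(f):[0,1]\to\mathbb{R}$ is defined by $J(f)(x)=\int_0^x f(t)\,dt$. Conventions: $\log 0=-\infty$ and $\exp(-\infty)=0$; since $\log|J(f)|$ is bounded above, its integral over $[0,1]$ is well defined in $[-\infty,\infty)$. *)

(* Defs.v *)
From mathcomp Require Import all_boot all_order all_algebra.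
From mathcomp Require Import all_classical all_reals all_analysis.

Set Implicit Arguments.
Unset Strict Implicit.
Unset Printing Implicit Defensive.

Import Order.TTheory GRing.Theory Num.Theory.
Import numFieldNormedType.Exports.

Local Open Scope classical_set_scope.
Local Open Scope ring_scope.

(* A function on [0, 1] is represented by a function f : R -> R whose values
   outside [0, 1] are irrelevant; f belongs to L^oo([0, 1]) when its extension
   by zero [f \_ `[0, 1]] belongs to L^oo(R).  Elements are Borel representatives
   of the classes modulo almost everywhere equality (every Lebesgue-measurable
   function is almost everywhere equal to a Borel one), hence the almost
   everywhere bounds in [calF]. *)
Definition Linfty01 (R : realType) (f : R -> R) : Prop :=
  (f \_ `[0, 1] : R -> R) \in Lfun (@lebesgue_measure R) +oo%E.

Definition calF (R : realType) (m M : R) : set (R -> R) :=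
  [set f | [/\ Linfty01 f,
               {ae @lebesgue_measure R,
                  forall x : R, x \in `[0, 1] -> m <= f x <= M} &
               \int[@lebesgue_measure R]_(x in `[0, 1]) f x = 0]].

Definition J (R : realType) (f : R -> R) (x : R) : R :=
  \int[@lebesgue_measure R]_(t in `[0, x]) f t.

(* Main.v *)
Require Import Defs.
From mathcomp Require Import all_boot all_order all_algebra.
From mathcomp Require Import all_classical all_reals all_analysis.
From mathcomp Require Import measurable_realfun ring lra.
Import Order.TTheory GRing.Theory Num.Theory.
Import numFieldNormedType.Exports.
Set Implicit Arguments.
Unset Strict Implicit.
Unset Printing Implicit Defensive.
Local Open Scope classical_set_scope.
Local Open Scope ring_scope.

(** Write c = - m M / (M - m) and F = J f.  The extremal F is the tent with
    slopes M and m, of height c; its values are uniformly distributed on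
    [0, c], and the mean of ln (c u) for u uniform on [0, 1] is ln c - 1, which
    gives exactly the bound c / e.  The proof shows that every other |F| is
    stochastically dominated by this uniform law:

      |F| <= c, and {|F| <= t} has measure at least t / c for 0 < t <= c.

    The first part (slopes_in_bound) says that F stays under the tent.  For the
    second (sublevel_measure_ge), suppose that |F| exceeds t somewhere, say
    F > t.  As F vanishes at 0 and 1, it must climb from 0 to t and later
    descend from t to 0; with slopes in [m, M] this takes a time of at least
    t / M + t / (- m) = t / c, during which 0 < F < t.

    Domination bounds the mean of the logarithm (integral_lne_le).  Instead of
    integrating over all levels t, the logarithm is bounded by a step function
    at the levels c r ^+ k with 0 < r < 1: the resulting geometric sums are
    computed in closed form, and r tends to 1. *)

(** * Mean logarithm of a function dominated by a uniform law *)

Lemma measurable_lne_EFin (R : realType) :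
  measurable_fun [set: R] (fun x : R => lne x%:E).
Proof.
rewrite /lne; apply: measurable_fun_ifT => //.
- exact: measurable_fun_ler.
- by apply/measurable_EFinP; exact: measurable_ln.
Qed.

(** Comparing positive and negative parts separately covers integrals equal to
    -oo, such as that of ln |F| when F vanishes on a set of positive measure. *)
Lemma le_integral_measurable d (T : measurableType d) (R : realType)
    (mu : {measure set T -> \bar R}) (D : set T) (h g : T -> \bar R) :
  measurable D -> measurable_fun D h -> measurable_fun D g ->
  (forall x, D x -> (h x <= g x)%E) ->
  (\int[mu]_(x in D) h x <= \int[mu]_(x in D) g x)%E.
Proof.
move=> mD mh mg hg; rewrite [leLHS]integralE [leRHS]integralE.
apply: leeB; apply: ge0_le_integral => //.
- exact: measurable_funepos.
- exact: measurable_funepos.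
- move=> x Dx; apply: (@funepos_le _ _ D) => //; last by rewrite inE.
  by move=> y; rewrite inE; exact: hg.
- exact: measurable_funeneg.
- exact: measurable_funeneg.
- move=> x Dx; apply: (@funeneg_le _ _ D) => //; last by rewrite inE.
  by move=> y; rewrite inE; exact: hg.
Qed.

(** The exponent counts the levels c r, ..., c r ^+ n lying above y.  By
    induction on n: if y is below the last level c r ^+ n, the count is at most
    n and c r ^+ (count) is above that level; otherwise the last level does
    not contribute to the count. *)
Lemma le_geometric_step (R : realType) (c r y : R) (n : nat) :
  0 < c -> 0 < r < 1 -> y <= c ->
  y <= c * r ^+ (\sum_(k < n) (y <= c * r ^+ k.+1)%R).
Proof.
move=> c0 /andP[r0 r1] yc; elim: n => [|n IH]; first by rewrite big_ord0 mulr1.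
rewrite big_ord_recr /=; have [le|_] := boolP (y <= c * r ^+ n.+1); last first.
  by rewrite addn0.
apply: (le_trans le); rewrite ler_pM2l// addn1.
apply: ler_wiXn2l; rewrite ?ltnS ?(ltW r0) ?(ltW r1)//.
rewrite -[leqRHS]card_ord -sum1_card; apply: leq_sum => i _; exact: leq_b1.
Qed.

(** A step-function form of the layer-cake formula: by
    le_geometric_step, ln phi <= ln c + ln r * #{k | phi <= c r ^+ k.+1}, and the k-th level set
    has measure at least r ^+ k.+1 while ln r is negative.  Then
    ln r <= r - 1 makes the geometric sum telescope to - r * (1 - r ^+ n),
    which tends to -1 when n tends to infinity and then r to 1. *)
Lemma integral_lne_le_geometric d (T : measurableType d) (R : realType)
    (mu : {measure set T -> \bar R}) (D : set T) (phi : T -> R) (c r : R) n :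
  measurable D -> mu D = 1%E -> measurable_fun D phi -> 0 < c -> 0 < r < 1 ->
  (forall x, D x -> phi x <= c) ->
  (forall t, 0 < t <= c ->
    ((t / c)%:E <= mu (D `&` [set x | (phi x <= t)%R]))%E) ->
  (\int[mu]_(x in D) lne (phi x)%:E <= (ln c - r * (1 - r ^+ n))%:E)%E.
Proof.
move=> mD muD mphi c0 r01 phic dist; have /andP[r0 r1] := r01.
pose A k := D `&` [set x | (phi x <= c * r ^+ k.+1)%R].
have mA k : measurable (A k).
  rewrite (_ : A k = D `&` phi @^-1` `]-oo, (c * r ^+ k.+1)%R]); first exact: mphi.
  by apply/seteqP; split=> x; rewrite /A /= in_itv.
have ck k : 0 < c * r ^+ k.+1 <= c.
  rewrite mulr_gt0 ?exprn_gt0//= ger_pMr// exprn_ile1// ltW//.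
have muA k : ((r ^+ k.+1)%:E <= mu (A k))%E.
  apply: le_trans (dist _ (ck k)).
  by rewrite mulrAC divff ?gt_eqF// mul1r.
have muAfin k : mu (A k) \is a fin_num.
  rewrite ge0_fin_numE//; apply: (@le_lt_trans _ _ (mu D)).
    by apply: le_measure; rewrite ?inE// /A; apply: subIsetl.
  by rewrite muD ltry.
have intA k : mu.-integrable D (fun x => (\1_(A k) x)%:E).
  apply: measurable_bounded_integrable => //; first by rewrite muD ltry.
  exists 1; split; first exact: num_real.
  move=> x x1 y _ /=; rewrite indicE; case: (_ \in _); rewrite ?normr1 ?normr0 ltW//.
  exact: lt_trans x1.
have intS : mu.-integrable D (fun x => \sum_(k < n) (\1_(A k) x)%:E)%E.
  exact: integrable_sum.
have intZ : mu.-integrable D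
    (fun x => (ln r)%:E * \sum_(k < n) (\1_(A k) x)%:E)%E.
  exact: integrableZl.
have intc : mu.-integrable D (cst (ln c)%:E).
  apply: (@measurable_bounded_integrable _ _ _ _ (cst (ln c))) => //.
    by rewrite muD ltry.
  exists `|ln c|; split; first exact: num_real.
  by move=> x /ltW cx y _.
pose g x := (cst (ln c)%:E x + (ln r)%:E * \sum_(k < n) (\1_(A k) x)%:E)%E.
apply: (@le_trans _ _ (\int[mu]_(x in D) g x)%E).
  apply: le_integral_measurable => //.
  - exact: (measurableT_comp (@measurable_lne_EFin R)).
  - by apply: (measurable_int mu); exact: integrableD.
  move=> x Dx; rewrite /g sumEFin -EFinM -EFinD /lne.
  case: ifPn => [_|]; first exact: leNye.
  rewrite -ltNge => phi0.
  rewrite lee_fin.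
  have -> : \sum_(k < n) \1_(A k) x
      = (\sum_(k < n) (phi x <= c * r ^+ k.+1)%R)%N%:R :> R.
    rewrite natr_sum; apply: eq_bigr => k _; rewrite indicE; congr (nat_of_bool _)%:R.
    by apply/idP/idP; rewrite inE /A /=; [case|split].
  rewrite mulr_natr -lnXn// -lnM ?posrE ?exprn_gt0//.
  by rewrite ler_ln ?posrE ?mulr_gt0 ?exprn_gt0//; exact/le_geometric_step/phic.
rewrite /g integralD// integral_cst// muD mule1 integralZl// integral_sum//.
under eq_bigr do rewrite integral_indic//.
rewrite (_ : \sum_(k < n) mu (A k `&` D) = (\sum_(k < n) fine (mu (A k)))%:E)%E; last first.
  rewrite -sumEFin; apply: eq_bigr => k _; rewrite fineK//.
  by congr (mu _); apply/setIidPl; apply: subIsetl.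
rewrite -EFinM -EFinD lee_fin lerD2l.
have lnr : ln r <= r - 1.
  by rewrite -{1}(subrK 1 r) addrC le_ln1Dx// ltrBrDr addNr.
apply: (@le_trans _ _ ((r - 1) * \sum_(k < n) r ^+ k.+1)); last first.
  under eq_bigr do rewrite exprS.
  by rewrite -mulr_sumr mulrCA -subrX1 -mulrN opprB.
apply: (@le_trans _ _ (ln r * \sum_(k < n) r ^+ k.+1)); last first.
  by apply: ler_wpM2r => //; apply: sumr_ge0 => k _; rewrite exprn_ge0// ltW.
apply: ler_wnM2l; first by rewrite (le_trans lnr)// subr_le0 ltW.
by apply: ler_sum => k _; rewrite -lee_fin fineK.
Qed.

(** The hypothesis on sublevel sets says that phi is stochastically dominated
    by a uniform variable on [0, c], whose logarithm has mean ln c - 1. *)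
Lemma integral_lne_le d (T : measurableType d) (R : realType)
    (mu : {measure set T -> \bar R}) (D : set T) (phi : T -> R) (c : R) :
  measurable D -> mu D = 1%E -> measurable_fun D phi -> 0 < c ->
  (forall x, D x -> phi x <= c) ->
  (forall t, 0 < t <= c ->
    ((t / c)%:E <= mu (D `&` [set x | (phi x <= t)%R]))%E) ->
  (\int[mu]_(x in D) lne (phi x)%:E <= (ln c - 1)%:E)%E.
Proof.
move=> mD muD mphi c0 phic dist; apply/lee_addgt0Pr => e e0.
(* The bound 1 / 2 only keeps r positive when e is large. *)
pose r : R := Num.max (1 / 2) (1 - e / 2).
have r12 : 1 / 2 <= r by rewrite le_max lexx.
have re : 1 - e / 2 <= r by rewrite le_max lexx orbT.
have r1 : r < 1 by rewrite gt_max; apply/andP; split; lra.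
have r0 : 0 < r by lra.
have [n rn] : exists n, r ^+ n <= e / 2.
  have /cvgrPdist_le/(_ (e / 2)) :
      (GRing.exp r : R ^nat) x @[x --> \oo] --> (0 : R).
    by apply: cvg_expr; rewrite gtr0_norm.
  case=> [|n _ /(_ n) /=]; first lra.
  rewrite leqnn sub0r normrN ger0_norm; last by rewrite exprn_ge0 ?ltW.
  by move=> /(_ isT) rn; exists n.
have r01 : 0 < r < 1 by rewrite r0.
apply: (le_trans (integral_lne_le_geometric n mD muD mphi c0 r01 phic dist)).
rewrite -EFinD lee_fin.
have : r * r ^+ n <= 1 * (e / 2).
  by apply: ler_pM rn => //; rewrite ?exprn_ge0 ?(ltW r0) ?(ltW r1).
lra.
Qed.

(** * Functions with slopes in an interval *)

(** Stated on the whole line, so that it is stable under x -> - x and yields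
    plain continuity; this loses nothing, as a primitive of a function
    supported in [0, 1] is constant outside. *)
Definition slopes_in (R : realType) (m M : R) (F : R -> R) : Prop :=
  forall x y : R, x <= y -> m * (y - x) <= F y - F x <= M * (y - x).

Lemma slopes_in_opp (R : realType) (m M : R) (F : R -> R) :
  slopes_in m M F -> slopes_in (- M) (- m) (fun x => - F x).
Proof. by move=> hF x y /hF /andP[? ?]; apply/andP; split; lra. Qed.

Lemma slopes_in_reflect (R : realType) (m M : R) (F : R -> R) :
  slopes_in m M F -> slopes_in (- M) (- m) (fun x => F (- x)).
Proof.
move=> hF x y xy; have /hF/andP[? ?] : - y <= - x by rewrite lerN2.
by apply/andP; split; lra.
Qed.

Lemma slopes_in_continuous (R : realType) (m M : R) (F : R -> R) :
  slopes_in m M F -> continuous F.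
Proof.
move=> hF x; apply/cvgrPdist_le => e e0.
pose K := `|m| + `|M| + 1.
have K0 : 0 < K by rewrite /K ltr_wpDl// addr_ge0.
have lip y z : y <= z -> `|F y - F z| <= K * `|y - z|.
  move=> yz; have /andP[lo hi] := hF _ _ yz.
  rewrite (distrC y) (ger0_norm (x := z - y)) ?subr_ge0//.
  have d0 : 0 <= z - y by rewrite subr_ge0.
  have hm : - `|m| * (z - y) <= m * (z - y).
    by apply: ler_wpM2r => //; rewrite lerNl -normrN ler_norm.
  have hM : M * (z - y) <= `|M| * (z - y) by apply: ler_wpM2r => //; exact: ler_norm.
  have h1 : 0 <= `|m| * (z - y) by rewrite mulr_ge0.
  have h2 : 0 <= `|M| * (z - y) by rewrite mulr_ge0.
  rewrite /K !mulrDl mul1r ler_norml; apply/andP; split; lra.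
near=> y.
have : `|F x - F y| <= K * `|x - y|.
  have [xy|/ltW yx] := leP x y; first exact: lip.
  by rewrite distrC (distrC x); exact: lip.
move=> /le_trans; apply; rewrite mulrC -ler_pdivlMr//.
near: y; apply: (@cvgrPdist_le _ _ _ (nbhs x) _ id x).1; last exact: divr_gt0.
exact: cvg_id.
Unshelve. all: by end_near.
Qed.

Lemma last_point (R : realType) (a b : R) (C : set R) :
  closed C -> C a -> a <= b ->
  exists p, [/\ a <= p <= b, C p & forall x, p < x <= b -> ~ C x].
Proof.
move=> cC Ca ab.
have K : compact (`[a, b] `&` C).
  by apply: compact_closedI => //; exact: segment_compact.
have ne : `[a, b] `&` C !=set0 by exists a; split=> //=; rewrite in_itv /= lexx.
have [|p] := @compact_EVT_max _ _ (fun x : R => x) _ ne K.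
  by apply: continuous_subspaceT => x; exact: cvg_id.
rewrite inE /= in_itv /= => -[/andP[ap pb] Cp] max; exists p; split=> //.
  by rewrite ap.
move=> x /andP[px xb] Cx; have : x <= p.
  by apply: max; rewrite inE /= in_itv /= xb andbT; split=> //; lra.
by rewrite leNgt px.
Qed.

Lemma first_point (R : realType) (a b : R) (C : set R) :
  closed C -> C b -> a <= b ->
  exists p, [/\ a <= p <= b, C p & forall x, a <= x < p -> ~ C x].
Proof.
move=> cC Cb ab.
have K : compact (`[a, b] `&` C).
  by apply: compact_closedI => //; exact: segment_compact.
have ne : `[a, b] `&` C !=set0 by exists b; split=> //=; rewrite in_itv /= lexx ab.
have [|p] := @compact_EVT_min _ _ (fun x : R => x) _ ne K.
  by apply: continuous_subspaceT => x; exact: cvg_id.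
rewrite inE /= in_itv /= => -[/andP[ap pb] Cp] min; exists p; split=> //.
  by rewrite ap.
move=> x /andP[ax xp] Cx; have : p <= x.
  by apply: min; rewrite inE /= in_itv /= ax /=; split=> //; lra.
by rewrite leNgt xp.
Qed.

(** ]p, q[ runs from the last point of [a, b] where F <= 0 to the first
    subsequent point where F >= t.  Since F rises by at least t there, with
    slope at most M, its length is at least t / M. *)
Lemma crossing_up (R : realType) (m M : R) (F : R -> R) (a b t : R) :
  slopes_in m M F -> a <= b -> F a <= 0 -> 0 < t <= F b ->
  exists p q, [/\ a <= p, p <= q, q <= b, t <= M * (q - p) &
    forall x, p < x < q -> 0 < F x < t].
Proof.
move=> hF ab Fa /andP[t0 tFb]; have cF := slopes_in_continuous hF.
have [p [/andP[ap pb] /= Fp aft]] : exists p, [/\ a <= p <= b, F p <= 0 &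
    forall x, p < x <= b -> ~ F x <= 0].
  apply: (@last_point _ _ _ [set x | F x <= 0]) => //.
  by apply: (@preimage_closed _ _ F [set y | y <= 0]) => //; exact: closed_le.
have [q [/andP[pq qb] /= Fq bef]] : exists q, [/\ p <= q <= b, t <= F q &
    forall x, p <= x < q -> ~ t <= F x].
  apply: (@first_point _ _ _ [set x | t <= F x]) => //.
  by apply: (@preimage_closed _ _ F [set y | t <= y]) => //; exact: closed_ge.
exists p, q; split => //.
  by have /andP[_] := hF _ _ pq; lra.
move=> x /andP[px xq]; apply/andP; split; rewrite ltNge; apply/negP.
  by apply: aft; rewrite px/=; lra.
by apply: bef; rewrite xq andbT ltW.
Qed.

Lemma crossing_down (R : realType) (m M : R) (F : R -> R) (a b t : R) :
  slopes_in m M F -> a <= b -> F b <= 0 -> 0 < t <= F a ->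
  exists p q, [/\ a <= p, p <= q, q <= b, t <= - m * (q - p) &
    forall x, p < x < q -> 0 < F x < t].
Proof.
move=> /slopes_in_reflect hF ab Fb tFa.
have [p [q [ap pq qb tpq H]]] := @crossing_up _ _ _ _ (- b) (- a) t hF
  ltac:(by rewrite lerN2) ltac:(by rewrite /= opprK) ltac:(by rewrite /= opprK).
exists (- q), (- p); split; rewrite ?lerN2//; first by lra.
- by lra.
- by rewrite opprK (addrC (- p)).
move=> x /andP[qx xp]; rewrite -(opprK x); apply: H; apply/andP; split; lra.
Qed.

(** On the way up to x0 and on the way back down, F crosses the strip
    0 < F < t.  The two crossings are disjoint and last at least t / M and
    t / - m, whose sum is t divided by - m * M / (M - m). *)
Lemma sublevel_measure_pos (R : realType) (m M : R) (F : R -> R) (x0 t : R) :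
  m < 0 -> 0 < M -> slopes_in m M F -> F 0 <= 0 -> F 1 <= 0 ->
  0 <= x0 <= 1 -> 0 < t <= F x0 ->
  ((t / (- m * M / (M - m)))%:E <=
     @lebesgue_measure R (`[0%R, 1%R] `&` [set x | (`|F x| <= t)%R]))%E.
Proof.
move=> m0 M0 hF F0 F1 /andP[x00 x01] tF.
have [p [q [p0 pq qx tpq Hpq]]] := crossing_up hF x00 F0 tF.
have [p' [q' [xp' pq' q1 tpq' Hpq']]] := crossing_down hF x01 F1 tF.
have mF : measurable (`[0%R, 1%R] `&` [set x | (`|F x| <= t)%R]).
  have : measurable_fun setT F.
    by apply: continuous_measurable_fun; exact: slopes_in_continuous hF.
  move=> /(measurableT_comp (@normr_measurable R setT)) mF.
  apply: measurableI => //.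
  rewrite (_ : [set _ | _] = setT `&` (Num.norm \o F) @^-1` `]-oo, t]).
    exact: mF.
  by rewrite setTI; apply/seteqP; split=> x /=; rewrite in_itv.
have sub : `]p, q[ `|` `]p', q'[ `<=` `[0%R, 1%R] `&` [set x | (`|F x| <= t)%R].
  move=> x [] /=; rewrite !in_itv /= => /[dup] xpq /andP[px xq].
    have /andP[? ?] := Hpq _ xpq.
    by split; [apply/andP; split; lra|rewrite gtr0_norm// ltW].
  have /andP[? ?] := Hpq' _ xpq.
  by split; [apply/andP; split; lra|rewrite gtr0_norm// ltW].
apply: (@le_trans _ _ (@lebesgue_measure R (`]p, q[ `|` `]p', q'[))); last first.
  by apply: le_measure; rewrite ?inE//; exact: measurableU.
have len (a b : R) : a <= b -> @lebesgue_measure R `]a, b[ = (b - a)%:E.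
  move=> ab; rewrite lebesgue_measure_itv /= lte_fin; case: ltP => // ba.
  by rewrite (@le_anti _ _ a b) ?ab// subrr.
have -> : @lebesgue_measure R (`]p, q[ `|` `]p', q'[) =
    ((q - p)%:E + (q' - p')%:E)%E.
  rewrite measureU//; first by congr (_ + _)%E; exact: len.
  by apply/seteqP; split=> // x [] /=; rewrite !in_itv /= => /andP[? ?] /andP[? ?]; lra.
rewrite -EFinD lee_fin.
have -> : t / (- m * M / (M - m)) = t / M + t / - m.
  by field; rewrite ?oppr_eq0; apply/and3P; split; lra.
by apply: lerD; rewrite ler_pdivrMr ?oppr_gt0// mulrC.
Qed.

(** When |F| exceeds t somewhere, one sign suffices: -F has slopes in
    [-M, -m], and - m * M / (M - m) is invariant under (m, M) -> (-M, -m). *)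
Lemma sublevel_measure_ge (R : realType) (m M : R) (F : R -> R) (t : R) :
  m < 0 -> 0 < M -> slopes_in m M F -> F 0 = 0 -> F 1 = 0 ->
  0 < t <= - m * M / (M - m) ->
  ((t / (- m * M / (M - m)))%:E <=
     @lebesgue_measure R (`[0%R, 1%R] `&` [set x | (`|F x| <= t)%R]))%E.
Proof.
move=> m0 M0 hF F0 F1 /andP[t0 tc].
have [small|] := pselect (forall x, 0 <= x <= 1 -> `|F x| <= t).
  have -> : `[0%R, 1%R] `&` [set x | `|F x| <= t] = [set` `[0%R, 1%R]].
    by apply/setIidPl => x /=; rewrite in_itv /=; exact: small.
  rewrite lebesgue_measure_itv /= lte_fin ltr01 sube0 lee_fin ler_pdivrMr ?mul1r//.
  exact: lt_le_trans tc.
move=> /existsNP[x0 /not_implyP[x001 /negP]]; rewrite -ltNge => tF.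
have [Fx|Fx] := leP 0 (F x0).
  apply: (@sublevel_measure_pos _ _ _ _ x0); rewrite ?F0 ?F1 ?t0//=.
  by rewrite ltW// -(ger0_norm Fx).
have -> : - m * M / (M - m) = - (- M) * (- m) / (- m - - M) by field; lra.
have -> : [set x | `|F x| <= t] = [set x | `|- F x| <= t].
  by apply/seteqP; split=> x /=; rewrite normrN.
apply: (@sublevel_measure_pos _ _ _ (fun x => - F x) x0);
  rewrite ?oppr_lt0 ?oppr_gt0 ?F0 ?F1 ?oppr0 ?t0//=.
  exact: slopes_in_opp.
by rewrite ltW// -(ltr0_norm Fx).
Qed.

(** F lies below both M x and - m (1 - x), two lines that meet at height
    - m * M / (M - m); symmetrically from below. *)
Lemma slopes_in_bound (R : realType) (m M : R) (F : R -> R) (x : R) :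
  m < 0 -> 0 < M -> slopes_in m M F -> F 0 = 0 -> F 1 = 0 ->
  0 <= x <= 1 -> `|F x| <= - m * M / (M - m).
Proof.
move=> m0 M0 hF F0 F1 /andP[/hF + /hF]; rewrite F0 F1 !subr0 sub0r.
move=> /andP[h1 h2] /andP[h3 h4].
have Mm : 0 < M - m by lra.
rewrite ler_pdivlMr// -[M - m]gtr0_norm// -normrM ler_norml.
apply/andP; split; nra.
Qed.

(** * The primitive of a function of mean zero *)

(** For negative x the integral is over an empty set, so J h is 0 there; the
    slope bounds survive because 0 lies between m and M. *)
Lemma slopes_in_J (R : realType) (m M : R) (h : R -> R) :
  m <= 0 <= M -> measurable_fun setT h -> (forall x, m <= h x <= M) ->
  slopes_in m M (J h).
Proof.
move=> /andP[m0 M0] mh hb.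
pose mu := @lebesgue_measure R.
have itg (c : R -> R) (i : interval R) : (mu [set` i] < +oo)%E ->
    measurable_fun setT c -> (forall x, m <= c x <= M) ->
    mu.-integrable [set` i] (EFin \o c).
  move=> fi mc cb; apply: measurable_bounded_integrable => //.
    exact: measurable_funS mc.
  exists (Num.max (- m) M); split; first exact: num_real.
  move=> y /ltW ye x _ /=; apply: le_trans ye; have /andP[h1 h2] := cb x.
  by rewrite ler_norml lerNl !le_max lerN2 h1 h2 orbT.
have bnd (i : interval R) (l : R) : mu [set` i] = l%:E ->
    m * l <= \int[mu]_(t in [set` i]) h t <= M * l.
  move=> mui; have fi : (mu [set` i] < +oo)%E by rewrite mui ltry.
  have mM : m <= M by exact: le_trans M0.
  rewrite (_ : m * l = \int[mu]_(t in [set` i]) (cst m t)); last first.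
    by rewrite Rintegral_cst//; congr (_ * _); exact/esym/(congr1 fine mui).
  rewrite (_ : M * l = \int[mu]_(t in [set` i]) (cst M t)); last first.
    by rewrite Rintegral_cst//; congr (_ * _); exact/esym/(congr1 fine mui).
  apply/andP; split; apply: le_Rintegral => //;
    try (by apply: itg => //= x; rewrite ?lexx ?mM).
    by move=> x _; case/andP: (hb x).
  by move=> x _; case/andP: (hb x).
move=> x y xy.
have [x0|x0] := ltP x 0.
  have -> : J h x = 0 by rewrite /J set_itv_ge ?Rintegral_set0// bnd_simp -ltNge.
  rewrite subr0.
  have [y0|y0] := ltP y 0.
    have -> : J h y = 0 by rewrite /J set_itv_ge ?Rintegral_set0// bnd_simp -ltNge.
    by rewrite mulr_le0_ge0 ?mulr_ge0 ?subr_ge0.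
  have /bnd/andP[lo hi] : mu [set` `[0, y]] = y%:E.
    rewrite /mu lebesgue_measure_itv /= lte_fin; case: ltP; rewrite ?sube0// => y0'.
    by congr (_ %:E); apply/le_anti; rewrite y0 y0'.
  apply/andP; split; [apply: (le_trans _ lo) | apply: (le_trans hi)]; nra.
rewrite /J Rintegral_itvB ?bnd_simp//; last first.
  by apply: itg => //; rewrite /mu lebesgue_measure_itv /=; case: ifP; rewrite ?ltry.
apply: bnd; rewrite /mu lebesgue_measure_itv /= lte_fin; case: ltP => // yx.
by rewrite (@le_anti _ _ x y) ?xy// subrr.
Qed.

(** The bounds on f hold only almost everywhere on [0, 1]; clamping the
    extension by zero to [m, M] makes them hold everywhere and leaves the
    primitive unchanged. *)
Lemma J_clamp (R : realType) (m M : R) (f : R -> R) : m < 0 -> 0 < M ->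
  calF m M f ->
  exists h : R -> R, [/\ measurable_fun setT h, forall x, m <= h x <= M &
    forall x, x <= 1 -> J f x = J h x].
Proof.
move=> m0 M0 [fL fb _]; pose g := f \_ `[0, 1].
have mg : measurable_fun setT g.
  by move: fL; rewrite /Linfty01 inE /= => /andP[]; rewrite inE.
pose h x := Num.max m (Num.min M (g x)).
have mh : measurable_fun setT h.
  apply: measurable_maxr => //; exact: measurable_minr.
exists h; split => //.
  by move=> x; rewrite /h le_max lexx/= ge_max ge_min lexx/= andbT; lra.
move=> x x1.
have sub : `[0, x] `<=` `[0%R, 1%R].
  by move=> t /=; rewrite !in_itv /= => /andP[-> /le_trans->].
transitivity (J g x).
  by apply: eq_Rintegral => t; rewrite inE => /sub tI; rewrite /g patchE mem_set.
rewrite /J /Rintegral; congr fine; apply: ae_eq_integral => //.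
- by apply/measurable_EFinP; exact: measurable_funS mg.
- by apply/measurable_EFinP; exact: measurable_funS mh.
have ff : Filter (almost_everywhere (@lebesgue_measure R)).
  exact: (@ae_filter_ringOfSetsType _ _ _ (@lebesgue_measure R)).
apply: (@filterS _ _ ff _ _ _ fb) => t tb /sub tI; rewrite /h /g patchE mem_set//.
have /andP[mf fM] := tb tI.
by rewrite min_r// max_r.
Qed.

Theorem corollary2p5 (R : realType) (m M : R) (hm : m < 0) (hM : 0 < M)
    (f : R -> R) (hf : calF m M f) :
  (expeR (\int[@lebesgue_measure R]_(x in `[0%R, 1%R]) lne `|J f x|%:E)
     <= ((expR 1)^-1 * (- m * M / (M - m)))%:E)%E.
Proof.
have [h [mh hb Jfh]] := J_clamp hm hM hf.
have hF : slopes_in m M (J h) by apply: slopes_in_J => //; rewrite !ltW.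
have F0 : J h 0 = 0 by rewrite /J set_itv1 Rintegral_set1.
have F1 : J h 1 = 0 by rewrite -Jfh//; case: hf.
have c0 : 0 < - m * M / (M - m).
  by rewrite divr_gt0 ?mulr_gt0 ?oppr_gt0// subr_gt0 (lt_trans hm).
have -> : (\int[@lebesgue_measure R]_(x in `[0%R, 1%R]) lne `|J f x|%:E =
    \int[@lebesgue_measure R]_(x in `[0%R, 1%R]) lne `|J h x|%:E)%E.
  by apply: eq_integral => x; rewrite inE /= in_itv /= => /andP[_ /Jfh ->].
have -> : (expR 1)^-1 * (- m * M / (M - m)) = expR (ln (- m * M / (M - m)) - 1).
  by rewrite expRD lnK ?posrE// expRN mulrC.
rewrite -[leRHS]/(expeR (ln (- m * M / (M - m)) - 1)%:E) lee_expeR.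
apply: (@integral_lne_le _ _ R (@lebesgue_measure R) `[0%R, 1%R]
  (fun x => `|J h x|)) => //.
- by rewrite /= lebesgue_measure_itv /= lte_fin ltr01 sube0.
- apply: measurableT_comp => //; apply: measurable_funTS.
  apply: continuous_measurable_fun; exact: slopes_in_continuous hF.
- by move=> x /=; rewrite in_itv /=; exact: slopes_in_bound.
- by move=> t; exact: sublevel_measure_ge.
Qed.
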